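(* Let $D$ be an integral domain that is equal to $\bigcap_{\mathfrak{p} \in \mathcal{S}} D_{\mathfrak{p}}$ for some subset $\mathcal{S}$ of $\operatorname{Spec}(D)$ such that every nonzero element of $D$ lies in only finitely many $\mathfrak{p} \in \mathcal{S}$. Then $\operatorname{Int}(S^{-1}D) = S^{-1}\operatorname{Int}(D)$ for every multiplicative subset $S$ of $D$.
   Context: For an integral domain $A$ with quotient field $L$, $\operatorname{Int}(A) = \{f(X) \in L[X] : f(A) \subset A\}$ is the ring of integer-valued polynomials on $A$. Multiplicative subsets $S$ of $D$ are understood not to contain $0$, so that $S^{-1}D$ is a subring of the quotient field $K$ of $D$, and $S^{-1}\operatorname{Int}(D)$ is viewed as a subring of $K[X]$. All localizations $D_{\mathfrak{p}}$ are viewed inside $K$. *)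

(* Defs.v *)
From mathcomp Require Import all_boot all_order all_algebra.
From mathcomp Require Import all_classical.

Set Implicit Arguments.
Unset Strict Implicit.
Unset Printing Implicit Defensive.

Import GRing.Theory.

Notation "x %:F" := (@FracField.tofrac _ x) : ring_scope.

Local Open Scope classical_set_scope.
Local Open Scope ring_scope.

Definition spectrum (D : idomainType) : set (set D) :=
  [set p | idealr_closed [in p] /\ prime_idealr_closed [in p]].
Arguments spectrum : clear implicits.

(* GRing.mulr_closed includes 1 \in S. *)
Definition multiplicative_subset (D : idomainType) (S : set D) : Prop :=
  GRing.mulr_closed [in S] /\ ~ S 0.

Definition in_fraction (D : idomainType) : set {fraction D} :=
  range (fun x : D => x%:F).
Arguments in_fraction : clear implicits.

Definition localization (D : idomainType) (S : set D) : set {fraction D} :=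
  [set z | exists a s, S s /\ z = a%:F / s%:F].

Definition localization_at (D : idomainType) (p : set D) : set {fraction D} :=
  localization (~` p).

(* For a subring A of a field L: the quotient field of A, formed inside L. *)
Definition quotient_field (L : fieldType) (A : set L) : set L :=
  [set z | exists x y, [/\ A x, A y, y != 0 & z = x / y]].

(* Int(A), inside L[X]: the coefficients are required to lie in the quotient
   field of A, which a priori may be smaller than L. *)
Definition int_valued (L : fieldType) (A : set L) : set {poly L} :=
  [set f | f \is a polyOver [in quotient_field A] /\
           (forall a, A a -> A f.[a])].

Definition localization_poly (D : idomainType) (S : set D)
    (M : set {poly {fraction D}}) : set {poly {fraction D}} :=
  [set g | exists f s, [/\ M f, S s & g = (s%:F)^-1 *: f]].

(* Main.v *)
From HB Require Import structures.
Require Import Defs.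
From mathcomp Require Import all_boot all_order all_algebra.
From mathcomp Require Import all_classical.

Import GRing.Theory.

Local Open Scope classical_set_scope.
Local Open Scope ring_scope.

(* The q-difference t^n f(X) - f(tX) kills the term of degree n and multiplies
   the coefficient of X^i by t^n - t^i.

   By induction on the degree, f(D) in S^-1 D implies that t^n f(a/t) - f(a)
   lies in S^-1 D, hence so does f(a/t).

   Conversely, let f be in Int(S^-1 D), and let 0 != d in D with d f in D[X].
   For each p in P some s in S satisfies s f(D) in D_p: s = 1 works if d is not
   in p or if p does not meet S.  If t is in both p and S, then 1 - t^k is a unit
   of D_p, so t^n - t^i is a unit of M^-1 D, where M = S (D \ p), and the values
   f(t^i) in S^-1 D already force f to have coefficients in M^-1 D, by induction
   on the degree.  Only the finitely many p containing d need s != 1, so one s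
   works for all of them, and s f(D) lies in the intersection D of the D_p. *)

(** * The q-difference and induction on the degree *)

Definition qdiff {R : nzRingType} (t : R) (n : nat) (f : {poly R}) : {poly R} :=
  \poly_(i < n) ((t ^+ n - t ^+ i) * f`_i).

Lemma horner_qdiff {R : comNzRingType} (t : R) n (f : {poly R}) x :
  (size f <= n.+1)%N -> (qdiff t n f).[x] = t ^+ n * f.[x] - f.[t * x].
Proof.
move=> szf; rewrite horner_poly !(horner_coef_wide _ szf) mulr_sumr -sumrB.
rewrite big_ord_recr /= exprMn.
rewrite (_ : _ - _ = 0) ?addr0; last by rewrite mulrCA subrr.
by apply: eq_bigr => i _; rewrite exprMn !mulrBl mulrA [t ^+ i * _]mulrC mulrA.
Qed.

(** [qdiff t n f] has size at most n, so this is induction on a degree bound; n need not be the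
    exact degree of f. *)
Lemma poly_ind_qdiff {R : comNzRingType} (Q : {poly R} -> Prop) :
  Q 0 ->
  (forall n (f : {poly R}), (size f <= n.+1)%N -> (forall t, Q (qdiff t n f)) -> Q f) ->
  forall f, Q f.
Proof.
move=> Q0 QS f; have [n] := ubnP (size f); elim: n f => // n IHn f.
rewrite ltnS; case: n IHn => [_|n IHn szf].
  by rewrite leqn0 size_poly_eq0 => /eqP ->.
by apply: QS szf _ => t; apply: IHn; rewrite ltnS size_poly.
Qed.

(** Evaluating the q-difference at a/t expresses t^n f(a/t) through f(a). The q-difference again
    maps A into B, because A is closed under products and lies in B. *)
Lemma horner_fraction {L : fieldType} (A : set L) (B : subringClosed L)
    (f : {poly L}) :
  (forall a t, A a -> A t -> A (t * a)) -> (forall a, A a -> a \in B) ->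
  (forall a, A a -> f.[a] \in B) ->
  forall a t, A a -> A t -> t != 0 -> t^-1 \in B -> f.[a / t] \in B.
Proof.
move=> AM AB; elim/(@poly_ind_qdiff L): f => [|n f szf IHf] fB a t Aa At t0 tVB.
  by rewrite horner0 rpred0.
have -> : f.[a / t] = t ^- n * ((qdiff t n f).[a / t] + f.[a]).
  rewrite horner_qdiff // mulrCA mulfV // mulr1 subrK mulKf //.
  by rewrite expf_neq0.
rewrite rpredM ?rpredD ?fB -?exprVn ?rpredX // IHf // => b Ab.
rewrite horner_qdiff // rpredB //; last by apply/fB/AM.
by apply: rpredM; [apply/rpredX/AB|apply: fB].
Qed.

(** At t^j the q-difference involves only f(t^j) and f(t^(j+1)), so the powers of one t suffice.
    Induction puts (t^n - t^i) f_i in B, and up to sign t^n - t^i is t^i times 1 - t^(n-i), a unit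
    of B for i < n. *)
Lemma polyOver_powers {L : fieldType} (B : subringClosed L) (t : L)
    (f : {poly L}) :
  t \in B -> t != 0 -> t^-1 \in B ->
  (forall k, (0 < k)%N -> 1 - t ^+ k != 0 /\ (1 - t ^+ k)^-1 \in B) ->
  (forall i, f.[t ^+ i] \in B) -> f \is a polyOver B.
Proof.
move=> tB t0 tVB tkB; elim/(@poly_ind_qdiff L): f => [|n f szf IHf] fB.
  by rewrite rpred0.
have fiB i : (i < n)%N -> f`_i \in B.
  move=> lt_in; have /polyOverP/(_ i) : qdiff t n f \is a polyOver B.
    apply: IHf => j; rewrite horner_qdiff // -exprS.
    by rewrite rpredB ?rpredM ?rpredX ?fB.
  rewrite coef_poly lt_in; have [|n0 nB] := tkB (n - i)%N; first by rewrite subn_gt0.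
  have -> : t ^+ n - t ^+ i = - (t ^+ i * (1 - t ^+ (n - i))).
    by rewrite mulrBr mulr1 -exprD subnKC ?(ltnW lt_in) // opprB.
  set c := _ * (1 - _) => cfB.
  have c0 : c != 0 by rewrite mulf_neq0 ?expf_neq0.
  have -> : f`_i = - (c^-1 * (- c * f`_i)) by rewrite mulNr mulrN opprK mulKf.
  by rewrite rpredN rpredM // invfM -exprVn rpredM ?rpredX.
apply/polyOverP => i; have [/fiB //|] := ltnP i n.
rewrite leq_eqVlt => /predU1P[<-|lt_ni]; last first.
  by rewrite nth_default ?rpred0 // (leq_trans szf).
(* The q-difference kills the coefficient of X^n; it is recovered from f(1), the sum of all
   coefficients. *)
have -> : f`_n = f.[t ^+ 0] - \sum_(j < n) f`_j.
  rewrite expr0 (horner_coef_wide _ szf) big_ord_recr /= expr1n mulr1.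
  rewrite (eq_bigr (fun j : 'I_n => f`_j)) => [|j _].
    by rewrite addrAC subrr add0r.
  by rewrite expr1n mulr1.
by rewrite rpredB ?fB ?rpred_sum // => j _; apply: fiB.
Qed.

(** * Localizations inside the quotient field *)

Lemma fraction_ratio {D : idomainType} (z : {fraction D}) :
  exists a b : D, b != 0 /\ z = a%:F / b%:F.
Proof.
elim/quotW: z => x; have x0 := denom_ratioP x; exists x.1, x.2; split => //.
apply: (canRL (mulfK _)); first by rewrite tofrac_eq0.
(* The product of z and its denominator is compared with the numerator on representatives. *)
unlock FracField.tofrac; rewrite -[LHS]FracField.pi_mul; apply/eqmodP.
rewrite /= FracField.equivfE /FracField.mulf /=.
by rewrite !numden_Ratio ?mulf_neq0 ?oner_eq0 // !mulr1 mulrC.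
Qed.

Lemma multiplicative_neq0 {D : idomainType} {S : set D} {s} :
  multiplicative_subset S -> S s -> s%:F != 0.
Proof. by move=> [_ S0] Ss; rewrite tofrac_eq0; apply/eqP => s0; rewrite s0 in Ss. Qed.

Lemma multiplicativeM {D : idomainType} {S : set D} {s t} :
  multiplicative_subset S -> S s -> S t -> S (s * t).
Proof. by move=> [[_ SM] _] /mem_set Ss /mem_set St; apply/set_mem/SM. Qed.

Lemma multiplicative1 {D : idomainType} {S : set D} : multiplicative_subset S -> S 1.
Proof. by move=> [[S1 _] _]; apply/set_mem. Qed.

Lemma in_localization {D : idomainType} (S : set D) a s :
  S s -> localization S (a%:F / s%:F).
Proof. by exists a, s. Qed.

Lemma localization_tofrac {D : idomainType} (S : set D) a :
  multiplicative_subset S -> localization S a%:F.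
Proof.
by move=> /multiplicative1 S1; exists a, 1; rewrite tofrac1 divr1.
Qed.

Lemma localizationS {D : idomainType} {S T : set D} :
  S `<=` T -> localization S `<=` localization T.
Proof. by move=> ST _ [a [s [Ss ->]]]; apply/in_localization/ST. Qed.

Lemma localization_subring_closed {D : idomainType} {S : set D} :
  multiplicative_subset S -> GRing.subring_closed [in localization S].
Proof.
move=> S_mult; split.
- by apply/mem_set; rewrite -tofrac1; apply: localization_tofrac.
- move=> _ _ /set_mem[a [s [Ss ->]]] /set_mem[b [t [St ->]]]; apply/mem_set.
  have s0 := multiplicative_neq0 S_mult Ss; have t0 := multiplicative_neq0 S_mult St.
  exists (a * t - b * s), (s * t); split; first exact: multiplicativeM.
  by rewrite tofracB !tofracM -mulNr addf_div // mulNr.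
- move=> _ _ /set_mem[a [s [Ss ->]]] /set_mem[b [t [St ->]]]; apply/mem_set.
  by exists (a * b), (s * t); rewrite !tofracM mulf_div; split => //; apply: multiplicativeM.
Qed.

(** Packaged as a [subringClosed] structure so that the [rpred] lemmas and [polyOver] apply. *)
Definition localization_subring {D : idomainType} {S : set D}
    (S_mult : multiplicative_subset S) : subringClosed {fraction D} :=
  HB.pack (fun z => z \in localization S)
   (GRing.isSubringClosed.Build _ _ (localization_subring_closed S_mult)).

(** The product of the individual s works, since each [Q i] is stable under multiples. It serves for
    coefficients as well as for primes. *)
Lemma common_multiple {D : idomainType} (S : set D) (I : eqType) (r : seq I)
    (Q : I -> set D) :
  multiplicative_subset S ->
  (forall i s t, Q i s -> Q i (s * t)) ->
  {in r, forall i, exists2 s, S s & Q i s} ->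
  exists2 s, S s & {in r, forall i, Q i s}.
Proof.
move=> S_mult QM; elim: r => [_|i r IHr rQ]; first by exists 1; [exact: multiplicative1|].
have [j jr|s Ss sQ] := IHr; first by apply: rQ; rewrite in_cons jr orbT.
have [t St tQ] := rQ i (mem_head _ _).
exists (s * t) => [|j]; first exact: multiplicativeM.
by rewrite in_cons => /predU1P[->|/sQ/QM//]; rewrite mulrC; apply: QM.
Qed.

Lemma common_denominator {D : idomainType} {S : set D} {f : {poly {fraction D}}} :
  multiplicative_subset S -> (forall i, localization S f`_i) ->
  exists2 s, S s & forall i, in_fraction D (s%:F * f`_i).
Proof.
move=> S_mult fS.
have [i s t [a _ eq_a]|i _|s Ss sf] := common_multiple S _ (iota 0 (size f))
    (fun i s => in_fraction D (s%:F * f`_i)) S_mult.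
- by exists (a * t) => //; rewrite !tofracM eq_a mulrAC.
- have [a [s [Ss ->]]] := fS i; exists s => //; exists a => //.
  by rewrite mulrC divfK // (multiplicative_neq0 S_mult).
exists s => // i; have [lti|lei] := ltnP i (size f).
  by apply: sf; rewrite mem_iota.
by rewrite nth_default // mulr0; exists 0; rewrite ?tofrac0.
Qed.

Lemma spectrum_multiplicative {D : idomainType} {p : set D} :
  spectrum D p -> multiplicative_subset (~` p).
Proof.
move=> [[p0 p1 _] p_prime]; split; last by move/(_ (set_mem p0)).
split; first by apply/mem_set => /mem_set p1'; rewrite /= p1' in p1.
move=> s t /set_mem ps /set_mem pt; apply/mem_set => /mem_set/p_prime.
by case/orP => /set_mem.
Qed.

(** With T the complement of a prime p, localizing at this set yields the smallest ring containing
    both S^-1 D and D_p. *)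
Definition set_product {D : idomainType} (S T : set D) : set D :=
  [set x | exists s t, [/\ S s, T t & x = s * t]].

Lemma set_product_multiplicative {D : idomainType} {S T : set D} :
  multiplicative_subset S -> multiplicative_subset T ->
  multiplicative_subset (set_product S T).
Proof.
move=> S_mult T_mult; split; last first.
  move=> [s [t [Ss Tt /esym/eqP]]]; rewrite mulf_eq0 -(tofrac_eq0 s) -(tofrac_eq0 t).
  by rewrite (negPf (multiplicative_neq0 S_mult Ss)) (negPf (multiplicative_neq0 T_mult Tt)).
split.
  by apply/mem_set; exists 1, 1; rewrite mulr1; split => //; apply: multiplicative1.
move=> _ _ /set_mem[s [t [Ss Tt ->]]] /set_mem[s' [t' [Ss' Tt' ->]]].
by apply/mem_set; exists (s * s'), (t * t'); rewrite mulrACA; split => //; apply: multiplicativeM.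
Qed.

Lemma quotient_field_full {D : idomainType} {S : set D} z :
  multiplicative_subset S -> quotient_field (localization S) z.
Proof.
move=> S_mult; have [a [b [b0 ->]]] := fraction_ratio z.
by exists a%:F, b%:F; rewrite tofrac_eq0; split => //; apply: localization_tofrac.
Qed.

(** Lets D itself be treated as a localization, so that [quotient_field_full] applies to it. *)
Lemma in_fraction_localization {D : idomainType} :
  in_fraction D = localization [set 1].
Proof.
by apply/seteqP; split=> [_ [a _ <-]|_ [a [_ [-> ->]]]]; exists a;
  rewrite ?tofrac1 ?divr1 //; exists 1; rewrite tofrac1 divr1.
Qed.

Lemma set1_multiplicative {D : idomainType} : multiplicative_subset [set 1 : D].
Proof.
split; last by move/esym/eqP; rewrite oner_eq0.
split; first exact/mem_set.
by move=> s t /set_mem-> /set_mem->; rewrite mulr1; apply/mem_set.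
Qed.

(** * Denominators at a prime that meets S *)

Lemma polynomial_multiple_at {D : idomainType} {S p : set D}
    (f : {poly {fraction D}}) :
  multiplicative_subset S -> spectrum D p -> S `&` p !=set0 ->
  (forall a, in_fraction D a -> localization S f.[a]) ->
  exists2 s, S s & forall i, localization_at p (s%:F * f`_i).
Proof.
move=> S_mult p_spec [t [St pt]] fS.
have p_mult := spectrum_multiplicative p_spec.
have M_mult := set_product_multiplicative S_mult p_mult.
have SM : S `<=` set_product S (~` p).
  by move=> s Ss; exists s, 1; rewrite mulr1; split => //; apply: multiplicative1.
have pM : ~` p `<=` set_product S (~` p).
  by move=> s Ss; exists 1, s; rewrite mul1r; split => //; apply: multiplicative1.
have tp k : (0 < k)%N -> ~ p (1 - t ^+ k).
  case: k => // k _ /mem_set p1t; have [[_ p1 pD] _] := p_spec.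
  (* Since t^k t + (1 - t^(k+1)) = 1, the ideal p would contain 1. *)
  have := pD (t ^+ k) _ _ (mem_set pt) p1t.
  by rewrite -exprSr addrC subrK => p1'; rewrite p1' in p1.
have inv_M s : set_product S (~` p) s -> s%:F^-1 \in localization_subring M_mult.
  by move=> Ms; apply/mem_set; exists 1, s; rewrite tofrac1 mul1r.
have fM : f \is a polyOver (localization_subring M_mult).
  apply: (@polyOver_powers _ _ t%:F).
  - exact/mem_set/localization_tofrac.
  - exact: multiplicative_neq0 S_mult St.
  - exact/inv_M/SM.
  - move=> k k0; rewrite -tofracXn -tofrac1 -tofracB.
    by split; [exact: multiplicative_neq0 p_mult (tp _ k0)|exact/inv_M/pM/tp].
  - move=> i; apply/mem_set/(localizationS SM)/fS.
    by rewrite -tofracXn; exists (t ^+ i).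
(* The common denominator is s u with u a unit of D_p, so s alone brings the coefficients into
   D_p. *)
have [|_ [s [u [Ss pu ->]]] suf] := common_denominator (f := f) M_mult.
  by move=> i; apply/set_mem; apply: (polyOverP fM).
exists s => // i; have [a _ eq_a] := suf i; exists a, u; split => //.
by rewrite eq_a tofracM mulrAC mulfK // (multiplicative_neq0 p_mult pu).
Qed.

(** * The two inclusions *)

Lemma localization_int_valued {D : idomainType} (S : set D) :
  multiplicative_subset S ->
  localization_poly S (int_valued (in_fraction D)) `<=` int_valued (localization S).
Proof.
move=> S_mult _ [f [s [[_ fD] Ss ->]]]; split.
  by apply/(all_nthP 0) => i _; apply/mem_set/quotient_field_full.
pose B := localization_subring S_mult.
move=> _ [a [t [St ->]]]; apply/set_mem.
change ((s%:F^-1 *: f).[a%:F / t%:F] \in B).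
rewrite hornerZ rpredM //; first by apply/mem_set; exists 1, s; rewrite tofrac1 mul1r.
(* The set [A] is D rather than S^-1 D, because the values of f are known only on D. *)
apply: (@horner_fraction _ (in_fraction D)).
- by move=> _ _ [b _ <-] [c _ <-]; exists (c * b); rewrite ?tofracM.
- by move=> _ [b _ <-]; apply/mem_set/localization_tofrac.
- by move=> b /fD[c _ <-]; apply/mem_set/localization_tofrac.
- by exists a.
- by exists t.
- exact: multiplicative_neq0 S_mult St.
- by apply/mem_set; exists 1, t; rewrite tofrac1 mul1r.
Qed.

Lemma localization_scale {D : idomainType} (S : set D) s z :
  localization S z -> localization S (s%:F * z).
Proof.
move=> [a [t [St ->]]]; exists (s * a), t; rewrite tofracM mulrA.
by split.
Qed.

Theorem theorem1p1 (D : idomainType) (P : set (set D))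
  (P_spec : P `<=` spectrum D)
  (D_cap : in_fraction D = \bigcap_(p in P) localization_at p)
  (P_fin : forall x : D, x != 0 -> finite_set [set p | P p /\ p x])
  (S : set D) (S_mult : multiplicative_subset S) :
  int_valued (localization S) = localization_poly S (int_valued (in_fraction D)).
Proof.
apply/seteqP; split; last exact: localization_int_valued.
move=> f [_ fS].
have fDS a : in_fraction D a -> localization S f.[a].
  by move=> [b _ <-]; apply/fS/localization_tofrac.
have nz_mult : multiplicative_subset [set x : D | x != 0].
  split; last by rewrite /= eqxx.
  by split=> [|x y /set_mem x0 /set_mem y0]; apply/mem_set;
    rewrite /= ?oner_eq0 ?mulf_neq0.
have [|d /= d0 df] := common_denominator (f := f) nz_mult.
  move=> i; have [a [b [b0 ->]]] := fraction_ratio f`_i.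
  exact: in_localization.
(* The list [r] holds the finitely many primes of P that contain d; s is chosen for these alone. *)
have /finite_seqP[r r_d] := P_fin d d0.
have [|p pr|s Ss sf] := common_multiple S _ r
    (fun p s => forall a, in_fraction D a -> localization_at p (s%:F * f.[a])) S_mult.
- by move=> p s t sf a /sf; rewrite [s * t]mulrC tofracM -mulrA; apply: localization_scale.
- have [/P_spec p_spec _] : [set p | P p /\ p d] p by rewrite r_d.
  have [/(polynomial_multiple_at f S_mult p_spec)|] := pselect (S `&` p !=set0).
    move=> /(_ fDS)[s Ss sf]; exists s => // a [b _ <-]; rewrite -hornerZ.
    have p_mult := spectrum_multiplicative p_spec.
    apply/set_mem; apply: (@rpred_horner _ (localization_subring p_mult)).
      by apply/polyOverP => i; rewrite coefZ; apply/mem_set/sf.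
    exact/mem_set/localization_tofrac.
  (* When S misses p, S^-1 D is contained in D_p. *)
  move=> Sp; exists 1 => [|a /fDS]; first exact: multiplicative1.
  rewrite tofrac1 mul1r; apply: localizationS => t St pt.
  by apply: Sp; exists t.
exists (s%:F *: f), s; split=> //; last first.
  by rewrite scalerA mulVf ?scale1r // (multiplicative_neq0 S_mult).
split=> [|a Da].
  apply/(all_nthP 0) => i _; apply/mem_set; rewrite in_fraction_localization.
  exact: quotient_field_full _ set1_multiplicative.
rewrite D_cap => p Pp; rewrite hornerZ.
have [pd|pd] := pselect (p d).
  by apply: sf => //; have : [set` r] p by rewrite -r_d.
(* Here d is a unit of D_p and d f has coefficients in D, so f = d^-1 (d f) already maps D into
   D_p. *)
have p_mult := spectrum_multiplicative (P_spec _ Pp).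
apply: localization_scale; have [b _ <-] := Da.
apply/set_mem; rewrite -[f.[_]](mulKf (x := d%:F)) ?tofrac_eq0 // -hornerZ.
change (d%:F^-1 * (d%:F *: f).[b%:F] \in localization_subring p_mult).
rewrite rpredM ?rpred_horner //.
- by apply/mem_set; exists 1, d; rewrite tofrac1 mul1r.
- apply/polyOverP => i; rewrite coefZ; have [c _ <-] := df i.
  exact/mem_set/localization_tofrac.
- exact/mem_set/localization_tofrac.
Qed.
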